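(* Let $\mathcal{M}\subset B(\mathcal{H})$ be a unital operator space. Suppose that $\pi:C^*(\mathcal{M})\rightarrow B(\mathcal{H}_\pi)$ is a $*$-representation possessing the approximate unique extension property with respect to $\mathcal{M}$ and let $\psi:C^*(\mathcal{M})\rightarrow B(\mathcal{H}_\pi)$ be a unital completely positive map satisfying $\psi|_{\mathcal{M}}=\pi|_{\mathcal{M}}$. Then the following statements hold. (i) Every $*$-representation $\sigma:C^*(\mathrm{Im}\,\psi)\rightarrow B(\mathcal{H}_\sigma)$ such that $\sigma|_{\ker\Gamma_\psi}=0$ has the unique extension property with respect to $\mathrm{Im}\,\psi$. (ii) The map $\Gamma_\psi$ is a minimal $\mathrm{Im}\,\pi$-projection in $\mathrm{UCP}(C^*(\mathrm{Im}\,\psi),B(\mathcal{H}_\pi))$.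
   Context: A unital operator space is a linear subspace $\mathcal{M}\subset B(\mathcal{H})$, $\mathcal{H}$ a Hilbert space, containing the identity; $C^*(\mathcal{M})\subset B(\mathcal{H})$ is the $C^*$-algebra it generates. $*$-representations of unital $C^*$-algebras are on Hilbert spaces and are unital. A $*$-representation $\sigma:C^*(\mathcal{M})\to B(\mathcal{H}_\sigma)$ has the unique extension property with respect to $\mathcal{M}$ if, whenever $\psi:C^*(\mathcal{M})\to B(\mathcal{H}_\sigma)$ is unital completely positive with $\psi|_{\mathcal{M}}=\sigma|_{\mathcal{M}}$, then $\psi=\sigma$ (in (i) this is used with the unital operator space $\mathrm{Im}\,\psi$). It has the approximate unique extension property with respect to $\mathcal{M}$ if, for every such $\psi$, there is a net of unitaries $u_\beta\in B(\mathcal{H}_\sigma)$ with $u_\beta^*\psi(t)u_\beta\to\sigma(t)$ in the weak operator topology for every $t\in C^*(\mathcal{M})$. The map $\Gamma_\psi$: for $\pi$ with the approximate unique extension property and $\psi$ as in the claim, $\mathrm{Im}\,\pi\subset C^*(\mathrm{Im}\,\psi)$ and $\Gamma_\psi:C^*(\mathrm{Im}\,\psi)\to\mathrm{Im}\,\pi$ denotes the (unique, existing) $*$-homomorphism with $\Gamma_\psi\circ\psi=\pi$; it is a conditional expectation, i.e. a contractive projection onto $\mathrm{Im}\,\pi$. For unital operator spaces $\mathcal{M}\subset\mathcal{N}$, $\mathrm{UCP}(\mathcal{M},\mathcal{N})$ is the set of unital completely positive maps $\mathcal{M}\to\mathcal{N}$. An idempotent in it is a $\varphi$ with range in $\mathcal{M}$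 and $\varphi\circ\varphi=\varphi$; idempotents are ordered by $\varphi\prec\varphi'$ iff $\varphi\circ\varphi'=\varphi'\circ\varphi=\varphi$. For a subspace $\mathcal{F}\subset\mathcal{M}$, an idempotent is a minimal $\mathcal{F}$-projection if it fixes $\mathcal{F}$ pointwise and is minimal with respect to $\prec$ among the idempotents of $\mathrm{UCP}(\mathcal{M},\mathcal{N})$ that fix $\mathcal{F}$ pointwise. *)

(* Defs.v *)
From HB Require Import structures.
From mathcomp Require Import all_boot all_order all_algebra.
From mathcomp Require Import complex.
From mathcomp Require Import all_classical all_reals topology normedtype.

Set Implicit Arguments.
Unset Strict Implicit.
Unset Printing Implicit Defensive.

Import Order.TTheory GRing.Theory Num.Theory.
Import numFieldNormedType.Exports.

Local Open Scope classical_set_scope.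
Local Open Scope ring_scope.
Local Open Scope complex_scope.

(* The inner product is linear in its first argument. *)
HB.mixin Record NormedModule_isHilbert (R : realType) (H : Type)
    of CompleteNormedModule R[i] H := {
  inner : H -> H -> R[i];
  inner_linear : forall (a : R[i]) (x y z : H),
    inner (a *: x + y) z = a * inner x z + inner y z;
  innerC : forall x y : H, inner y x = Num.conj (inner x y);
  inner_norm : forall x : H, inner x x = `|x| ^+ 2
}.

#[short(type="hilbertType")]
HB.structure Definition Hilbert (R : realType) :=
  {H of CompleteNormedModule R[i] H & NormedModule_isHilbert R H}.

Notation "'<| x , y |>" := (inner x y) : ring_scope.

Record bop (R : realType) (H : hilbertType R) := Bop {
  bop_fun :> H -> H;
  bop_linear : linear bop_fun;
  bop_bounded : exists c : R[i], forall x, `|bop_fun x| <= c * `|x|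
}.

Notation "''B(' H )" := (bop H) (format "''B(' H )") : type_scope.

HB.instance Definition _ (R : realType) (H : hilbertType R) (T : 'B(H)) :=
  GRing.isLinear.Build R[i] H H *:%R T (bop_linear T).

HB.instance Definition _ (R : realType) (H : hilbertType R) :=
  gen_eqMixin 'B(H).
HB.instance Definition _ (R : realType) (H : hilbertType R) :=
  gen_choiceMixin 'B(H).

Section BoundedOperators.
Variables (R : realType) (H : hilbertType R).
Implicit Types (S T U : 'B(H)) (x y : H) (a b : R[i]).

Lemma bopP S T : S =1 T -> S = T.
Proof.
case: S T => [f Lf Bf] [g Lg Bg] /= /funext fg; subst g.
by congr Bop; exact: Prop_irrelevance.
Qed.

Lemma bop_bound T : exists2 c : R[i], 0 <= c & forall x, `|T x| <= c * `|x|.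
Proof.
have [c Tc] := bop_bounded T; exists `|c| => // x.
have [->|x0] := eqVneq x 0; first by rewrite linear0 !normr0 mulr0.
apply: (le_trans (Tc x)); rewrite ler_wpM2r// real_ler_norm//.
have : 0 <= c * `|x| by rewrite (le_trans _ (Tc x)).
by rewrite pmulr_lge0 ?normr_gt0// => /ger0_real.
Qed.

Fact bop0_linear : linear (fun _ : H => 0 : H).
Proof. by move=> a x y; rewrite scaler0 addr0. Qed.

Fact bop0_bounded : exists c : R[i], forall x : H, `|0 : H| <= c * `|x|.
Proof. by exists 0 => x; rewrite normr0 mul0r. Qed.

Definition bop0 := Bop bop0_linear bop0_bounded.

Fact bop1_linear : linear (id : H -> H).
Proof. by []. Qed.

Fact bop1_bounded : exists c : R[i], forall x : H, `|x| <= c * `|x|.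
Proof. by exists 1 => x; rewrite mul1r. Qed.

Definition bop1 := Bop bop1_linear bop1_bounded.

Fact bopD_linear S T : linear (fun x => S x + T x).
Proof. by move=> a x y; rewrite !linearP scalerDr addrACA. Qed.

Fact bopD_bounded S T : exists c : R[i], forall x, `|S x + T x| <= c * `|x|.
Proof.
have [[c Sc] [d Td]] := (bop_bounded S, bop_bounded T); exists (c + d) => x.
by rewrite (le_trans (ler_normD _ _))// mulrDl lerD.
Qed.

Definition bopD S T := Bop (bopD_linear S T) (bopD_bounded S T).

Fact bopZ_linear a T : linear (fun x => a *: T x).
Proof. by move=> b x y; rewrite linearP scalerDr !scalerA mulrC. Qed.

Fact bopZ_bounded a T : exists c : R[i], forall x, `|a *: T x| <= c * `|x|.
Proof.
have [c Tc] := bop_bounded T; exists (`|a| * c) => x.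
by rewrite normrZ -mulrA ler_wpM2l.
Qed.

Definition bopZ a T := Bop (bopZ_linear a T) (bopZ_bounded a T).

Fact bopM_linear S T : linear (S \o T).
Proof. by move=> a x y; rewrite /= !linearP. Qed.

Fact bopM_bounded S T : exists c : R[i], forall x, `|(S \o T) x| <= c * `|x|.
Proof.
have [[c c0 Sc] [d Td]] := (bop_bound S, bop_bounded T); exists (c * d) => x.
by rewrite (le_trans (Sc _))// -mulrA ler_wpM2l.
Qed.

Definition bopM S T := Bop (bopM_linear S T) (bopM_bounded S T).

Definition bopN T := bopZ (-1) T.

Fact bopDA : associative bopD.
Proof. by move=> S T U; apply: bopP => x /=; rewrite addrA. Qed.

Fact bopDC : commutative bopD.
Proof. by move=> S T; apply: bopP => x /=; rewrite addrC. Qed.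

Fact bop0D : left_id bop0 bopD.
Proof. by move=> T; apply: bopP => x /=; rewrite add0r. Qed.

Fact bopND : left_inverse bop0 bopN bopD.
Proof. by move=> T; apply: bopP => x /=; rewrite scaleN1r addNr. Qed.

HB.instance Definition _ :=
  GRing.isZmodule.Build 'B(H) bopDA bopDC bop0D bopND.

Fact bopMA : associative bopM.
Proof. by move=> S T U; apply: bopP. Qed.

Fact bop1M : left_id bop1 bopM.
Proof. by move=> T; apply: bopP. Qed.

Fact bopM1 : right_id bop1 bopM.
Proof. by move=> T; apply: bopP. Qed.

Fact bopMDl : left_distributive bopM bopD.
Proof. by move=> S T U; apply: bopP. Qed.

Fact bopMDr : right_distributive bopM bopD.
Proof. by move=> S T U; apply: bopP => x /=; rewrite linearD. Qed.

(* Not a nzRingType, since H may be the zero space. *)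
HB.instance Definition _ :=
  GRing.Zmodule_isPzRing.Build 'B(H) bopMA bop1M bopM1 bopMDl bopMDr.

Fact bopZA a b T : bopZ a (bopZ b T) = bopZ (a * b) T.
Proof. by apply: bopP => x /=; rewrite scalerA. Qed.

Fact bop1Z : left_id 1 bopZ.
Proof. by move=> T; apply: bopP => x /=; rewrite scale1r. Qed.

Fact bopZDr : right_distributive bopZ +%R.
Proof. by move=> a S T; apply: bopP => x /=; rewrite scalerDr. Qed.

Fact bopZDl T : {morph bopZ^~ T : a b / a + b}.
Proof. by move=> a b; apply: bopP => x /=; rewrite scalerDl. Qed.

HB.instance Definition _ :=
  GRing.Zmodule_isLmodule.Build R[i] 'B(H) bopZA bop1Z bopZDr bopZDl.

(* The norm of a normed R[i]-module takes its (real) values in R[i], hence the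
   use of Re and %:C around the supremum in R. *)
Definition opnorm T : R[i] :=
  (sup [set complex.Re `|T x| | x in [set x : H | `|x| <= 1]])%:C.

Fact opnorm_ub T x : `|x| <= 1 -> `|T x| <= opnorm T.
Proof.
move=> x1; rewrite -(RRe_real (normr_real (T x))) lecR; apply: ub_le_sup.
  have [c c0 Tc] := bop_bound T; exists (complex.Re c) => _ [y /= y1 <-].
  rewrite -lecR !RRe_real ?normr_real ?ger0_real// (le_trans (Tc y))//.
  by rewrite ler_piMr.
by exists x.
Qed.

Lemma opnorm_le T (c : R[i]) :
  (forall x, `|x| <= 1 -> `|T x| <= c) -> opnorm T <= c.
Proof.
move=> Tc; have c0 : 0 <= c by rewrite (le_trans _ (Tc 0 _))// normr0.
rewrite -(RRe_real (ger0_real c0)) lecR; apply: ge_sup.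
  by exists (complex.Re `|T 0|), 0 => //=; rewrite normr0.
by move=> _ [x /= x1 <-]; rewrite -lecR !RRe_real ?normr_real ?ger0_real ?Tc.
Qed.

Lemma opnormP T x : `|T x| <= opnorm T * `|x|.
Proof.
have [->|x0] := eqVneq x 0; first by rewrite linear0 !normr0 mulr0.
have nx0 : 0 < `|x| by rewrite normr_gt0.
rewrite -ler_pdivrMr//; have /(_ (`|x|^-1 *: x)) := @opnorm_ub T.
rewrite linearZ/= !normrZ normfV normr_id mulVf ?normr_eq0// => /(_ (lexx _)).
by rewrite mulrC.
Qed.

Fact opnormD S T : opnorm (S + T) <= opnorm S + opnorm T.
Proof.
apply: opnorm_le => x x1; rewrite (le_trans (ler_normD _ _))//.
by rewrite lerD ?opnorm_ub.
Qed.

Fact opnorm_ge0 T : 0 <= opnorm T.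
Proof. by rewrite (le_trans _ (@opnorm_ub T 0 _))// normr0. Qed.

Fact opnormZ a T : opnorm (a *: T) = `|a| * opnorm T.
Proof.
have le_opnormZ b U : opnorm (b *: U) <= `|b| * opnorm U.
  by apply: opnorm_le => x x1; rewrite normrZ ler_wpM2l ?opnorm_ub.
apply/le_anti; rewrite le_opnormZ/=; have [->|a0] := eqVneq a 0.
  by rewrite normr0 mul0r opnorm_ge0.
rewrite -ler_pdivlMl ?normr_gt0// -normfV.
by have := le_opnormZ a^-1 (a *: T); rewrite scalerA mulVf// scale1r.
Qed.

Fact opnorm_eq0 T : opnorm T = 0 -> T = 0.
Proof.
move=> T0; apply: bopP => x; apply/eqP; rewrite -normr_le0.
by rewrite (le_trans (opnormP T x))// T0 mul0r.
Qed.

HB.instance Definition _ :=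
  Lmodule_isNormed.Build R[i] 'B(H) opnormD opnormZ opnorm_eq0.

(* By the Riesz representation theorem such an operator exists, and it is
   unique; the default value 0 of xget is never used. *)
Definition adj T : 'B(H) :=
  xget 0 [set S : 'B(H) | forall x y, '<| T x, y |> = '<| x, S y |>].

Definition unitary T := adj T * T = 1 /\ T * adj T = 1.

Definition linear_subspace (M : set 'B(H)) :=
  M 0 /\ forall a S T, M S -> M T -> M (a *: S + T).

Definition unital_operator_space (M : set 'B(H)) :=
  linear_subspace M /\ M 1.

Definition unital_Cstar_algebra (A : set 'B(H)) :=
  [/\ unital_operator_space A,
      forall S T, A S -> A T -> A (S * T),
      forall T, A T -> A (adj T) &
      closed A].

Definition Cstar (M : set 'B(H)) : set 'B(H) :=
  smallest unital_Cstar_algebra M.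

(* Positivity of the operator on the Hilbert space H^n with operator entries
   A i j. *)
Definition positive_mx n (A : 'M['B(H)]_n) :=
  forall x : 'I_n -> H, 0 <= \sum_i \sum_j '<| A i j (x j), x i |>.

Definition directed (I : Type) (le : I -> I -> Prop) :=
  [/\ inhabited I, forall i, le i i,
      forall i j k, le i j -> le j k -> le i k &
      forall i j, exists k, le i k /\ le j k].

Definition tails (I : Type) (le : I -> I -> Prop) : set_system I :=
  filter_from setT (fun i => [set j | le i j]).

Definition wot_cvg (I : Type) (le : I -> I -> Prop) (T_ : I -> 'B(H)) T :=
  forall x y, ('<| T_ i x, y |> : R[i]^o) @[i --> tails le] -->
              ('<| T x, y |> : R[i]^o).

End BoundedOperators.

(* A map defined on a subspace M of B(H) is represented by a function on all of
   B(H); only its values on M matter in what follows. *)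
Section Maps.
Variables (R : realType) (H K : hilbertType R).
Implicit Types (M A : set 'B(H)) (f g : 'B(H) -> 'B(K)).

Definition linear_on M f :=
  forall (a : R[i]) S T, M S -> M T -> f (a *: S + T) = a *: f S + f T.

Definition completely_positive M f :=
  forall n (T : 'M['B(H)]_n), (forall i j, M (T i j)) ->
    positive_mx T -> positive_mx (map_mx f T).

Definition ucp M f := [/\ linear_on M f, f 1 = 1 & completely_positive M f].

Definition star_hom A f :=
  [/\ linear_on A f,
      forall S T, A S -> A T -> f (S * T) = f S * f T &
      forall T, A T -> f (adj T) = adj (f T)].

Definition star_rep A f := star_hom A f /\ f 1 = 1.

Definition unique_extension M f :=
  forall g, ucp (Cstar M) g -> (forall t, M t -> g t = f t) ->
    forall t, Cstar M t -> g t = f t.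

Definition approx_unique_extension M f :=
  forall g, ucp (Cstar M) g -> (forall t, M t -> g t = f t) ->
    exists (I : Type) (le : I -> I -> Prop) (u : I -> 'B(K)),
      [/\ directed le, forall i, unitary (u i) &
          forall t, Cstar M t ->
            wot_cvg le (fun i => adj (u i) * g t * u i) (f t)].

Definition ker_on A f : set 'B(H) := [set t | A t /\ f t = 0].

End Maps.

(* A is the C*-algebra on which psi and pi are defined, and G is the map denoted
   Gamma_psi. *)
Definition is_Gamma (R : realType) (H K : hilbertType R) (A : set 'B(H))
    (pi psi : 'B(H) -> 'B(K)) (G : 'B(K) -> 'B(K)) :=
  [/\ star_hom (Cstar (psi @` A)) G,
      G @` Cstar (psi @` A) `<=` pi @` A &
      forall t, A t -> G (psi t) = pi t].

Section Projections.
Variables (R : realType) (H : hilbertType R).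
Implicit Types (F M N : set 'B(H)) (f g : 'B(H) -> 'B(H)).

Definition UCP M N : set ('B(H) -> 'B(H)) :=
  [set f | ucp M f /\ f @` M `<=` N].

Definition idempotent_UCP M N f :=
  [/\ UCP M N f, f @` M `<=` M & forall t, M t -> f (f t) = f t].

Definition proj_le M f g :=
  forall t, M t -> f (g t) = f t /\ g (f t) = f t.

Definition fixes F f := forall t, F t -> f t = t.

Definition minimal_projection F M N f :=
  [/\ idempotent_UCP M N f, fixes F f &
      forall g, idempotent_UCP M N g -> fixes F g -> proj_le M g f ->
        forall t, M t -> g t = f t].

End Projections.

(* Main.v *)
(* Let [A = C*(M)] and [B = C*(psi A)]. Since [pi = psi] on [M], the range of [pi]
   lies in [B], so [Gamma] fixes [pi A], and a representation [sigma] of [B]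
   killing [ker Gamma] satisfies [sigma o psi = sigma o pi].

   (i) If [g] is ucp and agrees with [sigma] on [psi A], then [g o psi] is
   multiplicative on [A], and the Schwarz inequality for [g] and [psi] gives
     g(psi(a))^* g(psi(a)) <= g(psi(a)^* psi(a)) <= g(psi(a^* a))
                            = g(psi(a))^* g(psi(a)).
   Hence [psi A] lies in the multiplicative domain of [g], so that [g] is a
   *-homomorphism on [B] and coincides with [sigma].

   (ii) If [g] is an idempotent below [Gamma] that fixes [pi A], then
   [g t = g (Gamma t) = Gamma t] because [Gamma t] is in [pi A]. *)

Require Import Defs.
From mathcomp Require Import all_boot all_order all_algebra.
From mathcomp Require Import complex ring lra.
From mathcomp Require Import all_classical all_reals topology normedtype sequences.

Set Implicit Arguments.
Unset Strict Implicit.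
Unset Printing Implicit Defensive.

Import Order.TTheory GRing.Theory Num.Theory.
Import numFieldNormedType.Exports.

Local Open Scope classical_set_scope.
Local Open Scope ring_scope.
Local Open Scope complex_scope.

(** * Norms and inner products as real numbers *)

Section RealNorm.
Variables (R : realType) (V : normedModType R[i]).
Implicit Types (x y : V) (a : R[i]).

(** Norms in a normed [R[i]]-module are real elements of [R[i]]; passing to [R] gives a total order,
    on which [lra] and [nra] work. *)
Definition rnorm x : R := complex.Re `|x|.

Lemma norm_rnorm x : `|x| = (rnorm x)%:C.
Proof. by rewrite /rnorm (RRe_real (normr_real x)). Qed.

Lemma rnorm_ge0 x : 0 <= rnorm x.
Proof. by rewrite -lecR -norm_rnorm; exact: normr_ge0. Qed.

Lemma rnormD x y : rnorm (x + y) <= rnorm x + rnorm y.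
Proof. by rewrite -lecR rmorphD/= -!norm_rnorm ler_normD. Qed.

Lemma rnormN x : rnorm (- x) = rnorm x.
Proof. by rewrite /rnorm normrN. Qed.

Lemma rnormB x y : rnorm (x - y) = rnorm (y - x).
Proof. by rewrite -opprB rnormN. Qed.

Lemma rnorm0 : rnorm 0 = 0.
Proof. by rewrite /rnorm normr0. Qed.

Lemma rnorm_eq0 x : rnorm x = 0 -> x = 0.
Proof. by move=> x0; apply/normr0_eq0; rewrite norm_rnorm x0. Qed.

Lemma rnormZ a x : rnorm (a *: x) = complex.Re `|a| * rnorm x.
Proof.
rewrite /rnorm normrZ -{1}(RRe_real (normr_real a)) -{1}(RRe_real (normr_real x)).
by rewrite -rmorphM.
Qed.

Lemma Re_norm_real (t : R) : complex.Re `|t%:C| = `|t|.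
Proof. by rewrite normc_def/= expr0n addr0 sqrtr_sqr. Qed.

Lemma rnormZr (t : R) x : rnorm (t%:C *: x) = `|t| * rnorm x.
Proof. by rewrite rnormZ Re_norm_real. Qed.

Lemma rnorm_cvgP (I : Type) (F : set_system I) {FF : Filter F} (u : I -> V) l :
  u i @[i --> F] --> l <->
  forall e : R, 0 < e -> \forall i \near F, rnorm (u i - l) <= e.
Proof.
split=> [/cvgrPdistC_le ul e e0|ul].
  have := ul e%:C; rewrite ltcR => /(_ e0); apply: filterS => i.
  by rewrite norm_rnorm lecR.
apply/cvgrPdistC_le => -[e e'] e0.
(* A positive element of [R[i]] has zero imaginary part, so the radius may be taken in [R]. *)
have -> : (e +i* e')%C = e%:C by move: e0; rewrite ltcE/= => /andP[/eqP-> _].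
have {}e0 : 0 < e by move: e0; rewrite ltcE/= => /andP[].
by apply: filterS (ul e e0) => i; rewrite norm_rnorm lecR.
Qed.

Lemma closure_rnorm (A : set V) x :
  (forall e : R, 0 < e -> exists2 y, A y & rnorm (x - y) <= e) -> closure A x.
Proof.
move=> Ax B /nbhs_ballP[[e e'] /= e0 xB].
have ee : (e +i* e')%C = e%:C by move: e0; rewrite ltcE/= => /andP[/eqP-> _].
have {}e0 : 0 < e by move: e0; rewrite ltcE/= => /andP[].
have [|y Ay xy] := Ax (e / 2); first by rewrite divr_gt0.
exists y; split=> //; apply: xB; rewrite -ball_normE/= ee norm_rnorm ltcR.
by rewrite (le_lt_trans xy)// gtr_pMr// invf_lt1 ?ltr1n.
Qed.

Lemma closure_rnormP (A : set V) x : closure A x ->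
  forall e : R, 0 < e -> exists2 y, A y & rnorm (x - y) <= e.
Proof.
move=> Ax e e0; have [|y [Ay]] := Ax (ball x e%:C).
  by apply: nbhsx_ballx; rewrite ltcR.
by rewrite -ball_normE/= norm_rnorm ltcR => /ltW xy; exists y.
Qed.

End RealNorm.

Lemma cauchy_rnorm (R : realType) (V : completeNormedModType R[i]) (u : nat -> V) :
  (forall e : R, 0 < e -> exists N, forall m n, (N <= m)%N -> (N <= n)%N ->
     rnorm (u m - u n) <= e) ->
  exists l : V, u n @[n --> \oo] --> l.
Proof.
move=> uC; suff : cvg (u n @[n --> \oo]) by move=> ?; exists (lim (u n @[n --> \oo])).
apply: cauchy_cvg; apply: cauchy_exP => -[e e'] e0.
have ee : (e +i* e')%C = e%:C by move: e0; rewrite ltcE/= => /andP[/eqP-> _].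
have {}e0 : 0 < e by move: e0; rewrite ltcE/= => /andP[].
have [|N uN] := uC (e / 2); first by rewrite divr_gt0.
exists (u N), N => // n /= Nn; rewrite -ball_normE/= ee norm_rnorm ltcR.
by rewrite (le_lt_trans (uN _ _ _ _))// gtr_pMr// invf_lt1 ?ltr1n.
Qed.

Section RealInner.
Variables (R : realType) (H : hilbertType R).
Implicit Types (x y z : H) (a : R[i]).

(** A symmetric real bilinear form with the same norm; the imaginary part of [inner] returns through
    multiplication by ['i]. *)
Definition rin x y : R := complex.Re '<| x, y |>.

Lemma rinC x y : rin x y = rin y x.
Proof. by rewrite /rin innerC; case: '<|_, _|>. Qed.

Lemma innerDl x y z : '<| x + y, z |> = '<| x, z |> + '<| y, z |>.
Proof. by have := inner_linear 1 x y z; rewrite scale1r mul1r. Qed.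

Lemma inner0l z : '<| 0, z |> = 0.
Proof. by apply: (@addIr _ '<| 0, z |>); rewrite -innerDl !add0r. Qed.

Lemma innerZl a x z : '<| a *: x, z |> = a * '<| x, z |>.
Proof. by have := inner_linear a x 0 z; rewrite !addr0 inner0l addr0. Qed.

Lemma innerZr a x z : '<| x, a *: z |> = Num.conj a * '<| x, z |>.
Proof. by rewrite innerC innerZl rmorphM/= -innerC. Qed.

Lemma innerDr x y z : '<| z, x + y |> = '<| z, x |> + '<| z, y |>.
Proof. by rewrite innerC innerDl rmorphD/= -!innerC. Qed.

Lemma rinDl x y z : rin (x + y) z = rin x z + rin y z.
Proof. by rewrite /rin innerDl raddfD. Qed.

Lemma rinDr x y z : rin z (x + y) = rin z x + rin z y.
Proof. by rewrite rinC rinDl !(rinC z). Qed.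

Lemma rinNl x z : rin (- x) z = - rin x z.
Proof. by rewrite /rin -scaleN1r innerZl mulN1r raddfN. Qed.

Lemma rinNr x z : rin z (- x) = - rin z x.
Proof. by rewrite rinC rinNl rinC. Qed.

Lemma rinZl (t : R) x z : rin (t%:C *: x) z = t * rin x z.
Proof. by rewrite /rin innerZl; case: '<|_, _|> => a b /=; rewrite mul0r subr0. Qed.

Lemma rinZr (t : R) x z : rin z (t%:C *: x) = t * rin z x.
Proof. by rewrite rinC rinZl rinC. Qed.

Lemma rin0l z : rin 0 z = 0.
Proof. by rewrite /rin inner0l. Qed.

Lemma rin0r z : rin z 0 = 0.
Proof. by rewrite rinC rin0l. Qed.

Lemma rin_suml I (r : seq I) (P : pred I) (F : I -> H) z :
  rin (\sum_(i <- r | P i) F i) z = \sum_(i <- r | P i) rin (F i) z.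
Proof.
by elim/big_rec2: _ => [|i s x _ <-]; [exact: rin0l|exact: rinDl].
Qed.

Lemma rin_sumr I (r : seq I) (P : pred I) (F : I -> H) z :
  rin z (\sum_(i <- r | P i) F i) = \sum_(i <- r | P i) rin z (F i).
Proof. by rewrite rinC rin_suml; apply: eq_bigr => i _; rewrite rinC. Qed.

Lemma rin_norm x : rin x x = rnorm x ^+ 2.
Proof. by rewrite /rin inner_norm norm_rnorm -rmorphXn. Qed.

Lemma rin_ge0 x : 0 <= rin x x.
Proof. by rewrite rin_norm sqr_ge0. Qed.

Lemma Im_inner x y : complex.Im '<| x, y |> = - rin ('i *: x) y.
Proof. by rewrite /rin innerZl; case: '<|_, _|> => a b /=; ring. Qed.

Lemma inner_rinP x y z w : (forall a, rin (a *: x) y = rin (a *: z) w) ->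
  '<| x, y |> = '<| z, w |>.
Proof.
move=> xyzw; have := xyzw 1; have := xyzw 'i; rewrite !scale1r => Im Re.
have := Im_inner x y; rewrite Im -Im_inner; move: Re; rewrite /rin.
by case: '<| x, y |> => ? ?; case: '<| z, w |> => ? ? /= -> ->.
Qed.

Lemma rin_inj y z : (forall x, rin x y = rin x z) -> y = z.
Proof.
move=> yz; apply/subr0_eq/rnorm_eq0/eqP; rewrite -sqrf_eq0 -rin_norm.
by rewrite rinDr rinNr yz subrr.
Qed.

Lemma rin_CauchySchwarz x y : rin x y <= rnorm x * rnorm y.
Proof.
have [/rnorm_eq0->|x0] := eqVneq (rnorm x) 0; first by rewrite rin0l rnorm0 mul0r.
have [/rnorm_eq0->|y0] := eqVneq (rnorm y) 0; first by rewrite rin0r rnorm0 mulr0.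
(* The square expands to [2 |x| |y| (|x| |y| - rin x y)]. *)
have := rin_ge0 ((rnorm y)%:C *: x - (rnorm x)%:C *: y).
rewrite !(rinDl, rinDr, rinNl, rinNr, rinZl, rinZr) (rinC y x) !rin_norm.
have {}x0 : 0 < rnorm x by rewrite lt_def x0 rnorm_ge0.
have {}y0 : 0 < rnorm y by rewrite lt_def y0 rnorm_ge0.
move=> h; suff : 0 <= (rnorm x * rnorm y) * (rnorm x * rnorm y - rin x y).
  by rewrite pmulr_rge0 ?mulr_gt0// subr_ge0.
nra.
Qed.

End RealInner.

(** * Riesz representation and adjoints *)

Lemma eventually_inv (R : realType) (e : R) : 0 < e -> \forall n \near \oo, n.+1%:R^-1 <= e.
Proof.
move=> e0; exists (Num.bound e^-1) => // n /= en.
rewrite -[leRHS]invrK lef_pV2 ?posrE ?invr_gt0 ?ltr0n//.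
rewrite (le_trans (ltW (archi_boundP _))) ?invr_ge0 ?(ltW e0)// ler_nat.
exact: leqW.
Qed.

Section Riesz.
Variables (R : realType) (H : hilbertType R).
Implicit Types (x y z : H).

(* The representing vector maximizes [2 g x - |x|^2]: a maximizing sequence is
   Cauchy by the parallelogram law, and its limit represents [g] because the
   first variation vanishes there. *)
Lemma riesz_real (g : H -> R) (c : R) :
  (forall x y, g (x + y) = g x + g y) ->
  (forall (t : R) x, g (t%:C *: x) = t * g x) ->
  (forall x, g x <= c * rnorm x) ->
  exists z, forall x, g x = rin x z.
Proof.
move=> gD gZ gc; pose Q x := 2 * g x - rin x x.
have supQ : has_sup (range Q).
  split; first by exists (Q 0), 0.
  exists (c ^+ 2) => _ [x _ <-]; rewrite /Q rin_norm.
  have := gc x; have := sqr_ge0 (c - rnorm x); nra.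
pose s := sup (range Q).
have Qs x : Q x <= s by apply: ub_le_sup; [exact: supQ.2|exists x].
have /choice[u uQ] (n : nat) : exists x, s - n.+1%:R^-1 < Q x.
  have [|_ [x _ <-] ?] := @sup_adherent _ (range Q) n.+1%:R^-1 _ supQ.
    by rewrite invr_gt0.
  by exists x.
(* By the parallelogram law [|u m - u n|^2 / 2] is [2 Q] at the midpoint minus [Q (u m) + Q (u n)],
   and [Q] at the midpoint is at most [s]. *)
have uC m n : rnorm (u m - u n) ^+ 2 <= 2 * (m.+1%:R^-1 + n.+1%:R^-1).
  have := Qs ((1 / 2)%:C *: (u m + u n)); have := uQ m; have := uQ n; rewrite /Q.
  rewrite -rin_norm gZ !gD !(rinDl, rinDr, rinNl, rinNr, rinZl, rinZr) (rinC (u n) (u m)).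
  by move: n.+1%:R^-1 m.+1%:R^-1 => p q; lra.
have [e e0|z uz] := @cauchy_rnorm _ H u.
  have e20 : 0 < e ^+ 2 / 4 by rewrite divr_gt0 ?exprn_gt0.
  have [N _ Ne] := eventually_inv e20; exists N => m n Nm Nn.
  rewrite -(ler_pXn2r (n:=2)) ?nnegrE ?rnorm_ge0 ?(ltW e0)//.
  have := uC m n; have := Ne m Nm; have := Ne n Nn => /=.
  by move: n.+1%:R^-1 m.+1%:R^-1 => p q; lra.
exists z => x; pose d := g x - rin x z.
(* Compare [Q (u n + t x) <= s] with [s < Q (u n) + 1 / (n + 1)] and let [u n] tend to [z]; the
   tolerances for [n] are chosen so that the total error is at most [e]. *)
have var t : 2 * t * d <= t ^+ 2 * rin x x.
  apply/ler_addgt0Pr => e e0.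
  have k0 : 0 < e / 4 / (1 + 2 * `|t| * rnorm x).
    by rewrite divr_gt0 ?ltr_pwDl ?mulr_ge0 ?rnorm_ge0 ?divr_gt0.
  have [n [zn en]] : exists n, rnorm (u n - z) <= e / 4 / (1 + 2 * `|t| * rnorm x) /\
      n.+1%:R^-1 <= e / 2.
    near \oo => n; exists n; split; near: n.
      by move/rnorm_cvgP : uz; apply.
    by apply: eventually_inv; rewrite divr_gt0.
  have := Qs (u n + t%:C *: x); have := uQ n; rewrite /Q.
  rewrite gD gZ !(rinDl, rinDr, rinNl, rinNr, rinZl, rinZr) (rinC (u n) x).
  have [le1 le2] : t * rin x (u n - z) <= e / 4 /\ - t * rin x (u n - z) <= e / 4.
    have le (y : H) r : `|r| = `|t| -> r * rin x (u n - z) <= e / 4.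
      move=> rt; rewrite -rinZr (le_trans (rin_CauchySchwarz _ _))//.
      rewrite rnormZr rt; move: zn; rewrite ler_pdivlMr ?ltr_pwDl ?mulr_ge0 ?rnorm_ge0//.
      have := rnorm_ge0 (u n - z); have := rnorm_ge0 x.
      have := normr_ge0 t; set A := `|t|; set B := rnorm x; set C := rnorm _.
      move=> ? ? ?; have : 0 <= A * B * C by rewrite !mulr_ge0.
      nra.
    by split; apply: le; rewrite ?normrN.
  rewrite /d; move: le1 le2 en; rewrite rinDr rinNr.
  by move: n.+1%:R^-1 => p; nra.
have k0 : 0 < 1 + rin x x by rewrite ltr_pwDl ?rin_ge0.
have := var (d / (1 + rin x x)); rewrite -(ler_pM2l (exprn_gt0 2 k0)).
rewrite [leLHS](_ : _ = 2 * (1 + rin x x) * d ^+ 2); last by field; lra.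
rewrite [leRHS](_ : _ = rin x x * d ^+ 2); last by field; lra.
move=> h; apply/subr0_eq/eqP; rewrite -/d -sqrf_eq0.
by apply/eqP/le_anti; rewrite sqr_ge0 andbT; have := rin_ge0 x; nra.
Unshelve. all: by end_near. Qed.

End Riesz.

Section OperatorNorm.
Variables (R : realType) (H : hilbertType R).
Implicit Types (S T U : 'B(H)) (x y z : H) (a : R[i]).

Lemma rnorm_bop T x : rnorm (T x) <= rnorm T * rnorm x.
Proof. by rewrite -lecR rmorphM/= -!norm_rnorm; exact: opnormP. Qed.

Lemma rnorm_bop_le T (c : R) : 0 <= c ->
  (forall x, rnorm (T x) <= c * rnorm x) -> rnorm T <= c.
Proof.
move=> c0 Tc; rewrite -lecR -norm_rnorm; apply: opnorm_le => x.
rewrite !norm_rnorm !lecR => x1; rewrite (le_trans (Tc x))//.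
by rewrite ler_piMr.
Qed.

Lemma rnormM S T : rnorm (S * T) <= rnorm S * rnorm T.
Proof.
apply: rnorm_bop_le => [|x]; first by rewrite mulr_ge0 ?rnorm_ge0.
by rewrite (le_trans (rnorm_bop S _))// -mulrA ler_wpM2l ?rnorm_ge0 ?rnorm_bop.
Qed.

Lemma bop_rin_inj S T : (forall x y, rin (S x) y = rin (T x) y) -> S = T.
Proof.
move=> ST; apply: bopP => x; apply: rin_inj => y.
by rewrite rinC ST rinC.
Qed.

(** Riesz is applied to the real functional [rin (T x) y]; replacing [x] by [a *: x] upgrades the
    real identity to the complex one, and linearity of [S] follows by uniqueness. *)
Fact adj_exists T : exists S : 'B(H), forall x y, '<| T x, y |> = '<| x, S y |>.
Proof.
have TS y : exists z, forall x, rin (T x) y = rin x z.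
  apply: (@riesz_real _ _ (fun x => rin (T x) y) (rnorm T * rnorm y)).
  - by move=> u v; rewrite linearD rinDl.
  - by move=> t u; rewrite linearZ rinZl.
  - move=> x; rewrite (le_trans (rin_CauchySchwarz _ _))// mulrAC.
    by rewrite ler_wpM2r ?rnorm_ge0 ?rnorm_bop.
have /choice[S TSE] y : exists z, forall x, '<| T x, y |> = '<| x, z |>.
  have [z Tz] := TS y; exists z => x; apply: inner_rinP => a.
  by rewrite -Tz linearZ.
have Slin : linear S.
  move=> a u v; apply: rin_inj => x.
  by rewrite /rin innerDr innerZr -!TSE innerDr innerZr.
have Sbnd : exists c : R[i], forall x, `|S x| <= c * `|x|.
  exists (rnorm T)%:C => y; rewrite !norm_rnorm -rmorphM lecR.
  have [->|y0] := eqVneq (rnorm (S y)) 0; first by rewrite mulr_ge0 ?rnorm_ge0.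
  rewrite -(ler_pM2l (_ : 0 < rnorm (S y))) ?lt_def ?y0 ?rnorm_ge0//.
  rewrite -expr2 -rin_norm {1}/rin -TSE (le_trans (rin_CauchySchwarz _ _))//.
  by rewrite mulrA ler_wpM2r ?rnorm_ge0// mulrC rnorm_bop.
by exists (Bop Slin Sbnd).
Qed.

Lemma adjP T x y : '<| T x, y |> = '<| x, adj T y |>.
Proof. exact: (xgetPex 0 (adj_exists T)). Qed.

Lemma rin_adj T x y : rin (T x) y = rin x (adj T y).
Proof. by rewrite /rin adjP. Qed.

Lemma rin_adjl T x y : rin (adj T x) y = rin x (T y).
Proof. by rewrite rinC -rin_adj rinC. Qed.

Lemma adj_unique S T : (forall x y, rin (T x) y = rin x (S y)) -> adj T = S.
Proof. by move=> TS; apply: bop_rin_inj => x y; rewrite rin_adjl rinC TS rinC. Qed.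

Lemma adjK T : adj (adj T) = T.
Proof. by apply: adj_unique => x y; rewrite rin_adjl. Qed.

Lemma adjM S T : adj (S * T) = adj T * adj S.
Proof. by apply: adj_unique => x y; rewrite /= !rin_adj. Qed.

Lemma adj1 : adj 1 = 1 :> 'B(H).
Proof. exact: adj_unique. Qed.

Lemma adjD S T : adj (S + T) = adj S + adj T.
Proof. by apply: adj_unique => x y; rewrite /= rinDl rinDr !rin_adj. Qed.

Lemma adjZr (t : R) T : adj (t%:C *: T) = t%:C *: adj T.
Proof. by apply: adj_unique => x y; rewrite /= rinZl rinZr rin_adj. Qed.

Lemma adjN T : adj (- T) = - adj T.
Proof. by apply: adj_unique => x y /=; rewrite !scaleN1r rinNl rinNr rin_adj. Qed.

Lemma adjB S T : adj (S - T) = adj S - adj T.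
Proof. by rewrite adjD adjN. Qed.

(** As [adj] is an involution, one inequality is enough; it follows from
    [|U^* y|^2 = rin (U (U^* y)) y] by Cauchy-Schwarz. *)
Lemma rnorm_adj T : rnorm (adj T) = rnorm T.
Proof.
suff le U : rnorm (adj U) <= rnorm U.
  by apply/le_anti; rewrite le -{1}[T]adjK le.
apply: rnorm_bop_le => [|y]; first exact: rnorm_ge0.
have [->|y0] := eqVneq (rnorm (adj U y)) 0; first by rewrite mulr_ge0 ?rnorm_ge0.
rewrite -(ler_pM2l (_ : 0 < rnorm (adj U y))) ?lt_def ?y0 ?rnorm_ge0//.
rewrite -expr2 -rin_norm -rin_adj (le_trans (rin_CauchySchwarz _ _))//.
by rewrite mulrA ler_wpM2r ?rnorm_ge0// mulrC rnorm_bop.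
Qed.

Lemma bop_complete (u : nat -> 'B(H)) :
  (forall e : R, 0 < e -> exists N, forall m n, (N <= m)%N -> (N <= n)%N ->
     rnorm (u m - u n) <= e) ->
  exists T : 'B(H), u n @[n --> \oo] --> T.
Proof.
move=> uC.
have uxB m n x : rnorm (u m x - u n x) <= rnorm (u m - u n) * rnorm x.
  by have := rnorm_bop (u m - u n) x; rewrite /= scaleN1r.
have /choice[L uL] x : exists l : H, u n x @[n --> \oo] --> l.
  apply: cauchy_rnorm => e e0; have x0 : 0 < 1 + rnorm x by rewrite ltr_pwDl ?rnorm_ge0.
  have [|N uN] := uC (e / (1 + rnorm x)); first by rewrite divr_gt0.
  exists N => m n Nm Nn; rewrite (le_trans (uxB _ _ _))//.
  have := uN m n Nm Nn; rewrite ler_pdivlMr//; apply: le_trans.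
  by rewrite ler_wpM2l ?rnorm_ge0// lerDr.
(* The pointwise limit is approached uniformly on the unit ball: go through an index beyond both [N]
   and a threshold depending on [x], which then disappears from the bound. *)
have uLB e : 0 < e -> exists N, forall n x, (N <= n)%N ->
    rnorm (u n x - L x) <= e * rnorm x.
  move=> e0; have [N uN] := uC e e0; exists N => n x Nn.
  apply/ler_addgt0Pr => d d0; have [M _ uM] := (rnorm_cvgP _ _).1 (uL x) d d0.
  have Mm := uM (maxn M N) (leq_maxl _ _); have Nm := leq_maxr M N.
  rewrite (_ : u n x - L x = (u n x - u (maxn M N) x) + (u (maxn M N) x - L x)).
    rewrite (le_trans (rnormD _ _))// lerD// (le_trans (uxB _ _ _))//.
    by rewrite ler_wpM2r ?rnorm_ge0// uN.
  by rewrite addrA subrK.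
have Llin : linear L.
  move=> a x y; have := uL (a *: x + y).
  rewrite (_ : (fun n => u n (a *: x + y)) = (fun n => a *: u n x + u n y)); last first.
    by apply/funext => n; rewrite linearP.
  move=> /(cvg_unique (@norm_hausdorff _ H)); apply.
  by apply: cvgD (uL y); apply: cvgZl_tmp; exact: uL.
have Lbnd : exists c : R[i], forall x, `|L x| <= c * `|x|.
  have [N uN] := uLB 1 ltr01; exists (1 + rnorm (u N))%:C => x.
  rewrite !norm_rnorm -rmorphM lecR mulrDl.
  rewrite -[L x](subrK (u N x)) (le_trans (rnormD _ _))// lerD ?rnorm_bop//.
  by rewrite rnormB uN.
exists (Bop Llin Lbnd); apply/rnorm_cvgP => e e0.
have [N uN] := uLB e e0; exists N => // n Nn; apply: rnorm_bop_le; first exact: ltW.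
by move=> x; rewrite /= scaleN1r uN.
Qed.

End OperatorNorm.

(** * C*-algebras and square roots *)

Section CstarAlgebra.
Variables (R : realType) (H : hilbertType R) (A : set 'B(H)).
Hypothesis hA : unital_Cstar_algebra A.
Implicit Types (S T : 'B(H)).

Lemma calg_lin a S T : A S -> A T -> A (a *: S + T).
Proof. by have [[[_ +] _] _ _ _] := hA; apply. Qed.

Lemma calg0 : A 0.
Proof. by have [[[]]] := hA. Qed.

Lemma calg1 : A 1.
Proof. by have [[]] := hA. Qed.

Lemma calgD S T : A S -> A T -> A (S + T).
Proof. by move=> AS AT; rewrite -[S]scale1r; apply: calg_lin. Qed.

Lemma calgZ a T : A T -> A (a *: T).
Proof. by move=> AT; rewrite -[_ *: _]addr0; apply: calg_lin => //; exact: calg0. Qed.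

Lemma calgB S T : A S -> A T -> A (S - T).
Proof. by move=> AS AT; apply: calgD => //; rewrite -scaleN1r; exact: calgZ. Qed.

Lemma calgM S T : A S -> A T -> A (S * T).
Proof. by have [_ + _ _] := hA; apply. Qed.

Lemma calg_adj T : A T -> A (adj T).
Proof. by have [_ _ + _] := hA; apply. Qed.

Lemma calg_closure T :
  (forall e : R, 0 < e -> exists2 S, A S & rnorm (T - S) <= e) -> A T.
Proof. by move=> AT; have [_ _ _ +] := hA; apply; exact: closure_rnorm. Qed.

End CstarAlgebra.

Section Cstar.
Variables (R : realType) (H : hilbertType R) (M : set 'B(H)).

Lemma sub_Cstar : M `<=` Cstar M.
Proof. exact: sub_smallest. Qed.

Lemma Cstar_min A : unital_Cstar_algebra A -> M `<=` A -> Cstar M `<=` A.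
Proof. exact: smallest_sub. Qed.

Lemma Cstar_algebra : unital_Cstar_algebra (Cstar M).
Proof.
split; first split; first split.
- by move=> A [hA _]; exact: calg0.
- by move=> a S T MS MT A MA; apply: (calg_lin MA.1); [exact: MS|exact: MT].
- by move=> A [hA _]; exact: calg1.
- by move=> S T MS MT A MA; apply: (calgM MA.1); [exact: MS|exact: MT].
- by move=> T MT A MA; apply: (calg_adj MA.1); exact: MT.
- by apply: closed_bigI => A [[]].
Qed.

End Cstar.

Lemma rnorm_small (R : realType) (V : normedModType R[i]) (x : V) (k : R) :
  (forall e : R, 0 < e -> rnorm x <= k * e) -> x = 0.
Proof.
move=> xe; apply: rnorm_eq0; apply/le_anti; rewrite rnorm_ge0 andbT.
apply/ler_addgt0Pr => e e0; rewrite add0r.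
have k0 : 0 < 1 + `|k| by rewrite ltr_pwDl.
rewrite (le_trans (xe (e / (1 + `|k|)) _)) ?divr_gt0//.
rewrite mulrA ler_pdivrMr// mulrC ler_wpM2l ?(ltW e0)//.
by rewrite (le_trans (ler_norm k))// lerDr.
Qed.

Lemma expr_small (R : realType) (r e : R) : 0 <= r -> r < 1 -> 0 < e ->
  exists N, forall n, (N <= n)%N -> r ^+ n <= e.
Proof.
move=> r0 r1 e0; have /cvgr0_norm_le : (fun n => r ^+ n) @ \oo --> 0.
  by apply: cvg_expr; rewrite ger0_norm.
move=> /(_ _ e0)[N _ rN]; exists N => n Nn.
by rewrite (le_trans (ler_norm _))//; exact: rN.
Qed.

Section SquareRoot.
Variables (R : realType) (H : hilbertType R) (A : set 'B(H)).
Hypothesis hA : unital_Cstar_algebra A.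

(* [b = 1 - y], where [y] is the limit of the iterates of the contraction
   [y |-> (x + y^2) / 2] of the ball of radius [|x|]. *)
Lemma sqrt_exists (x : 'B(H)) : A x -> adj x = x -> rnorm x < 1 ->
  exists b, [/\ A b, adj b = b & b * b = 1 - x].
Proof.
move=> Ax xsa; set r := rnorm x => r1; have r0 : 0 <= r := rnorm_ge0 x.
pose f y : 'B(H) := (1 / 2)%:C *: (x + y * y).
have half0 : `|1 / 2 : R| = 1 / 2 by rewrite ger0_norm// divr_ge0.
pose y n := iter n f 0.
have yA n : A (y n).
  elim: n => [|n IHn]; first exact: calg0.
  by apply: (calgZ hA); apply: (calgD hA) => //; exact: (calgM hA).
have ysa n : adj (y n) = y n.
  elim: n => [|n IHn]; first by apply: adj_unique => u v /=; rewrite rin0l rin0r.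
  by rewrite /= adjZr adjD adjM xsa IHn.
have yr n : rnorm (y n) <= r.
  elim: n => [|n IHn]; first by rewrite rnorm0.
  rewrite /= rnormZr half0; have := rnormD x (y n * y n).
  by have := rnormM (y n) (y n); have := rnorm_ge0 (y n); rewrite -/r; nra.
(* From [u^2 - v^2 = u (u - v) + (u - v) v]; on the ball of radius [r] the Lipschitz constant is
   thus at most [r < 1]. *)
have fB u v : rnorm (f u - f v) <= 1 / 2 * (rnorm u + rnorm v) * rnorm (u - v).
  rewrite -scalerBr rnormZr half0 -mulrA ler_wpM2l ?divr_ge0//.
  rewrite (_ : _ - _ = u * (u - v) + (u - v) * v); last first.
    by rewrite mulrBr mulrBl addrA subrK opprD addrACA subrr add0r.
  by rewrite (le_trans (rnormD _ _))// [leRHS]mulrDl lerD ?rnormM// [leRHS]mulrC rnormM.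
have yC k m : rnorm (y k - y (k + m)%N) <= r ^+ k.
  elim: k m => [|k IHk] m; first by rewrite expr0 rnormB subr0 (le_trans (yr _))// ltW.
  rewrite addSn /= (le_trans (fB _ _))// exprS ler_pM ?rnorm_ge0//.
    by rewrite mulr_ge0 ?divr_ge0 ?addr_ge0 ?rnorm_ge0.
  by have := yr k; have := yr (k + m)%N; lra.
have [e e0|z yz] := @bop_complete _ H y.
  have [N rN] := expr_small r0 r1 e0.
  have le k m : (N <= k)%N -> (k <= m)%N -> rnorm (y k - y m) <= e.
    by move=> Nk km; rewrite -(subnKC km) (le_trans (yC _ _))// rN.
  exists N => m n Nm Nn; case: (leqP m n) => mn; first exact: le.
  by rewrite rnormB le// ltnW.
have yze e : 0 < e -> exists n, rnorm (y n - z) <= e /\ rnorm (y n.+1 - z) <= e.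
  move=> e0; have [N _ yN] := (rnorm_cvgP _ _).1 yz e e0.
  by exists N; split; apply: yN => //=.
have zA : A z.
  apply: (calg_closure hA) => e e0; have [n [yn _]] := yze e e0.
  by exists (y n) => //; rewrite rnormB.
have zsa : adj z = z.
  apply/subr0_eq/(@rnorm_small _ _ _ 2) => e e0; have [n [yn _]] := yze e e0.
  rewrite (_ : adj z - z = - adj (y n - z) + (y n - z)).
    rewrite (le_trans (rnormD _ _))// rnormN rnorm_adj; lra.
  by rewrite adjB ysa opprB addrA subrK.
have zf : z = f z.
  apply/subr0_eq/(@rnorm_small _ _ _ (1 + 1 / 2 * (r + rnorm z))) => e e0.
  have [n [yn yn1]] := yze e e0.
  rewrite (_ : z - f z = - (y n.+1 - z) + (f (y n) - f z)).
    apply: (le_trans (rnormD _ _)); rewrite rnormN mulrDl.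
    apply: lerD; first by rewrite mul1r.
    apply: (le_trans (fB _ _)); apply: ler_pM => //; last by have := yr n; lra.
      by rewrite mulr_ge0 ?divr_ge0 ?addr_ge0 ?rnorm_ge0.
    exact: rnorm_ge0.
  by rewrite opprB addrA subrK.
exists (1 - z); split; first by apply: (calgB hA) => //; exact: (calg1 hA).
  by rewrite adjB adj1 zsa.
(* The fixed point equation [z = (x + z^2) / 2], rearranged so that [(1 - z)^2 = 1 - x]. *)
have -> : x = z + z - z * z.
  rewrite {1 2}zf -scalerDl -rmorphD/= (_ : 1 / 2 + 1 / 2 = 1); last by field.
  by rewrite scale1r addrK.
by rewrite mulrBl mul1r mulrBr mulr1 !opprD !opprK !addrA.
Qed.

End SquareRoot.

(** * Contractivity of unital *-representations *)

Section StarHom.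
Variables (R : realType) (H K : hilbertType R) (A : set 'B(H)).
Variable f : 'B(H) -> 'B(K).
Hypothesis hA : unital_Cstar_algebra A.

Lemma linear_onD S T : linear_on A f -> A S -> A T -> f (S + T) = f S + f T.
Proof. by move=> fl AS AT; have := fl 1 S T AS AT; rewrite !scale1r. Qed.

Lemma linear_on0 : linear_on A f -> f 0 = 0.
Proof.
move=> fl; have A0 := calg0 hA.
by apply: (@addIr _ (f 0)); rewrite -linear_onD// !add0r.
Qed.

Lemma linear_onZ a T : linear_on A f -> A T -> f (a *: T) = a *: f T.
Proof.
move=> fl AT; have := fl a T 0 AT (calg0 hA).
by rewrite linear_on0// !addr0.
Qed.

Lemma linear_onB S T : linear_on A f -> A S -> A T -> f (S - T) = f S - f T.
Proof.
move=> fl AS AT; rewrite -[- T]scaleN1r -[- f T]scaleN1r linear_onD//; last exact: (calgZ hA).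
by rewrite linear_onZ.
Qed.

(** Rescale to [|a'| < 1], which the slack [e] makes strict. Then [1 - a'^* a' = b^2] with [b]
    self-adjoint in [A], so [1 - f(a')^* f(a') = f(b)^2] is positive. *)
Lemma star_rep_contractive a : star_rep A f -> A a -> rnorm (f a) <= rnorm a.
Proof.
move=> [[fl fM fadj] f1] Aa; apply/ler_addgt0Pr => e e0.
set s := rnorm a + e; have s0 : 0 < s by rewrite ltr_wpDl ?rnorm_ge0.
pose a' := s^-1%:C *: a; have Aa' : A a' by exact: (calgZ hA).
have a'1 : rnorm a' < 1.
  rewrite rnormZr gtr0_norm ?invr_gt0// mulrC ltr_pdivrMr// mul1r.
  by rewrite /s ltrDl.
have Ax : A (adj a' * a') by apply: (calgM hA) => //; exact: (calg_adj hA).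
have [||b [Ab bsa bb]] := sqrt_exists hA Ax.
- by rewrite adjM adjK.
- rewrite (le_lt_trans (rnormM _ _))// rnorm_adj.
  by have := rnorm_ge0 a'; nra.
have fbb : f b * f b = 1 - adj (f a') * f a'.
  have [A1 Aa'adj] := (calg1 hA, calg_adj hA Aa').
  by rewrite -fM// bb linear_onB// f1 fM// fadj.
have fbsa : adj (f b) = f b by rewrite -fadj// bsa.
apply: rnorm_bop_le => [|x]; first exact: ltW.
have -> : a = s%:C *: a'.
  by rewrite scalerA -rmorphM/= divff ?scale1r// gt_eqF.
rewrite linear_onZ//= rnormZr gtr0_norm// ler_pM2l//.
rewrite -(ler_pXn2r (n:=2)) ?nnegrE ?rnorm_ge0// -!rin_norm.
rewrite [leLHS]rin_adj -subr_ge0 -rinNr -rinDr.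
have := rin_ge0 (f b x); rewrite rin_adj fbsa; have -> : f b (f b x) = (f b * f b) x by [].
by rewrite fbb /= scaleN1r.
Qed.

End StarHom.

(** * Complete positivity of *-representations *)

(** The increments of a convex sequence increase, so a positive first increment would give at least
    linear growth. *)
Lemma convex_bounded_decreasing (R : realType) (a : nat -> R) (C : R) :
  (forall k, 2 * a k.+1 <= a k + a k.+2) -> (forall k, a k <= C) -> a 1%N <= a 0%N.
Proof.
move=> a_convex aC; rewrite leNgt; apply/negP => a01.
pose d := a 1%N - a 0%N; have d0 : 0 < d by rewrite subr_gt0.
have step k : a k + d <= a k.+1.
  elim: k => [|k IHk]; first by rewrite /d addrC subrK.
  by have := a_convex k; lra.
have ak k : a 0%N + k%:R * d <= a k.
  elim: k => [|k IHk]; first by rewrite mul0r addr0.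
  by have := step k; rewrite -natr1; nra.
pose m := Num.bound ((C - a 0%N) / d).
have := archi_boundP (divr_ge0 (_ : 0 <= C - a 0%N) (ltW d0)).
rewrite subr_ge0 aC ltr_pdivrMr// => /(_ isT).
by have := ak m; have := aC m; rewrite -/m; lra.
Qed.

(** * Symmetric maps for a positive biadditive form *)

Section BiadditiveForm.
Variables (R : realType) (V : zmodType) (B : V -> V -> R).
Hypothesis BDl : forall x y z, B (x + y) z = B x z + B y z.
Hypothesis BNl : forall x z, B (- x) z = - B x z.
Hypothesis BC : forall x y, B x y = B y x.
Hypothesis B_ge0 : forall x, 0 <= B x x.
Variable Z : V -> V.
Hypothesis Zsym : forall x y, B (Z x) y = B x (Z y).

Let BDr x y z : B z (x + y) = B z x + B z y.
Proof. by rewrite BC BDl !(BC z). Qed.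

Let BNr x z : B z (- x) = - B z x.
Proof. by rewrite BC BNl BC. Qed.

(** In operator terms [Z - Z^2 = (1 - Z) Z (1 - Z) + Z (1 - Z) Z], a sum of positive terms, so
    [Z^2 <= Z <= 1]. *)
Lemma form_sqr_contraction :
  (forall x y, Z (x - y) = Z x - Z y) ->
  (forall x, 0 <= B (Z x) x <= B x x) -> forall x, B (Z x) (Z x) <= B x x.
Proof.
move=> ZB Z01 x; have /andP[_] := Z01 x; apply: le_trans.
have /andP[+ _] := Z01 (x - Z x); have /andP[_] := Z01 (Z x).
rewrite ZB !(BDl, BDr, BNl, BNr) (Zsym (Z x) x); lra.
Qed.

(* [k |-> |Z^k x|^2] is convex because [|Z^k x - Z^(k+2) x|^2 >= 0]. *)
Lemma form_power_bounded x (C : R) :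
  (forall k, B (iter k Z x) (iter k Z x) <= C) -> B (Z x) x <= B x x.
Proof.
move=> ZC; have Zx : B (Z x) (Z x) <= B x x.
  apply: (@convex_bounded_decreasing _ (fun k => B (iter k Z x) (iter k Z x)) C) => // k.
  have := B_ge0 (iter k Z x - iter k.+2 Z x); rewrite !(BDl, BDr, BNl, BNr).
  rewrite [B (iter k.+2 Z x) _]BC /= -(Zsym (iter k Z x) (Z _)); lra.
(* Expanding gives [2 B (Z x) x <= B x x + B (Z x) (Z x)], at most [2 B x x]. *)
have := B_ge0 (x - Z x); rewrite !(BDl, BDr, BNl, BNr) (BC x (Z x)); lra.
Qed.

End BiadditiveForm.

(** * Operator matrices acting on tuples of vectors *)

Section OperatorMatrix.
Variables (R : realType) (H : hilbertType R) (n : nat).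
Implicit Types (x y z : 'I_n -> H) (A B : 'M['B(H)]_n).

Definition tin x y : R := \sum_i rin (x i) (y i).

Definition act A x : 'I_n -> H := fun i => \sum_j A i j (x j).

Definition single i (u : H) : 'I_n -> H := fun j => if j == i then u else 0.

Lemma tinDl x y z : tin (x + y) z = tin x z + tin y z.
Proof. by rewrite /tin; under eq_bigr do rewrite rinDl; rewrite big_split. Qed.

Lemma tinC x y : tin x y = tin y x.
Proof. by apply: eq_bigr => i _; rewrite rinC. Qed.

Lemma tinDr x y z : tin z (x + y) = tin z x + tin z y.
Proof. by rewrite tinC tinDl !(tinC z). Qed.

Lemma tinNl x z : tin (- x) z = - tin x z.
Proof. by rewrite /tin -sumrN; apply: eq_bigr => i _; rewrite rinNl. Qed.

Lemma tinNr x z : tin z (- x) = - tin z x.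
Proof. by rewrite tinC tinNl tinC. Qed.

Lemma tin_ge0 x : 0 <= tin x x.
Proof. by apply: sumr_ge0 => i _; exact: rin_ge0. Qed.

Lemma tin_singler x i u : tin x (single i u) = rin (x i) u.
Proof.
rewrite /tin (bigD1 i)//= /single eqxx big1 ?addr0// => j /negPf->.
by rewrite rin0r.
Qed.

Lemma act_single A i j u : act A (single j u) i = A i j u.
Proof.
rewrite /act (bigD1 j)//= /single eqxx big1 ?addr0// => k /negPf->.
by rewrite linear0.
Qed.

Lemma actD A x y : act A (x + y) = act A x + act A y.
Proof.
by apply/funext => i; rewrite /act; under eq_bigr do rewrite linearD; rewrite big_split.
Qed.

Lemma actB A x y : act A (x - y) = act A x - act A y.
Proof.
by apply/funext => i; rewrite /act; under eq_bigr do rewrite linearB; rewrite sumrB.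
Qed.

Lemma actN A x : act A (- x) = - act A x.
Proof. by apply/funext => i; rewrite /act; under eq_bigr do rewrite linearN; rewrite sumrN. Qed.

Lemma bop_sumE (I : Type) (r : seq I) (P : pred I) (F : I -> 'B(H)) (u : H) :
  (\sum_(i <- r | P i) F i) u = \sum_(i <- r | P i) F i u.
Proof. by elim/big_rec2: _ => // i T S _ <-. Qed.

Lemma actM A B x : act (A * B) x = act A (act B x).
Proof.
apply/funext => i; rewrite /act; under eq_bigr do rewrite mxE bop_sumE.
by rewrite exchange_big; apply: eq_bigr => j _; rewrite linear_sum.
Qed.

Lemma act1 x : act 1 x = x.
Proof.
apply/funext => i; rewrite /act (bigD1 i)//= mxE eqxx big1 ?addr0// => j ji.
by rewrite mxE eq_sym (negPf ji).
Qed.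

Lemma actX A k x : act (A ^+ k) x = iter k (act A) x.
Proof.
by elim: k => [|k IHk]; rewrite ?expr0 ?act1// exprS actM IHk.
Qed.

Lemma act_sym A x y : (forall i j, adj (A i j) = A j i) ->
  tin (act A x) y = tin x (act A y).
Proof.
move=> Asym; rewrite /tin; under eq_bigr do rewrite rin_suml.
rewrite exchange_big; apply: eq_bigr => i _.
by rewrite rin_sumr; apply: eq_bigr => j _; rewrite rin_adj Asym.
Qed.

Let iscale x : 'I_n -> H := fun j => 'i *: x j.

Let rin_iscale (u v : H) : rin ('i *: u) v = - rin u ('i *: v).
Proof.
rewrite /rin innerZl innerC innerC innerZr conjCi.
by case: '<|u, v|> => a b /=; ring.
Qed.

Lemma Re_mx_form A x :
  complex.Re (\sum_i \sum_j '<| A i j (x j), x i |>) = tin (act A x) x.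
Proof.
rewrite raddf_sum; apply: eq_bigr => i _; rewrite raddf_sum rin_suml.
exact: eq_bigr.
Qed.

Lemma Im_mx_form A x :
  complex.Im (\sum_i \sum_j '<| A i j (x j), x i |>) = - tin (act A (iscale x)) x.
Proof.
rewrite raddf_sum -sumrN; apply: eq_bigr => i _; rewrite raddf_sum rin_suml -sumrN.
by apply: eq_bigr => j _; rewrite linearZ/= Im_inner.
Qed.

Lemma act_iscale A x : act A (iscale x) = iscale (act A x).
Proof.
by apply/funext => i; rewrite /act /iscale scaler_sumr; apply: eq_bigr => j _; rewrite linearZ.
Qed.

Lemma tin_iscale x y : tin (iscale x) y = - tin x (iscale y).
Proof. by rewrite /tin -sumrN; apply: eq_bigr => i _; exact: rin_iscale. Qed.

Lemma iscaleK x : iscale (iscale x) = - x.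
Proof. by apply/funext => i; rewrite /iscale scalerA -expr2 sqrCi scaleN1r. Qed.

(** Being nonnegative in [R[i]] includes having imaginary part zero; polarizing this at
    [iscale x + y] gives the symmetry of the entries. Conversely, [iscale] is skew for [tin], so
    symmetry makes the imaginary part equal to its own negative. *)
Lemma positive_mxP A : positive_mx A <->
  (forall i j, adj (A i j) = A j i) /\ forall x, 0 <= tin (act A x) x.
Proof.
split=> [Apos|[Asym Apos] x]; last first.
  rewrite lecE Re_mx_form Apos andbT Im_mx_form.
  have : tin (act A (iscale x)) x = - tin (act A (iscale x)) x.
    by rewrite {1}act_sym// tin_iscale -act_iscale tinC.
  by move=> h; apply/eqP => /=; lra.
have Im0 x : tin (act A (iscale x)) x = 0.
  by have := Apos x; rewrite lecE Im_mx_form => /andP[/eqP/= + _]; lra.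
split=> [i j|x]; last by have := Apos x; rewrite lecE Re_mx_form => /andP[].
have sym x y : tin (act A x) y = tin (act A y) x.
  have := Im0 (iscale x + y); have := Im0 (iscale x); have := Im0 y.
  have -> : iscale (iscale x + y) = - x + iscale y.
    by rewrite -iscaleK; apply/funext => k; rewrite /iscale -scalerDr.
  rewrite iscaleK actN tinNl !actD actN !(tinDl, tinDr, tinNl).
  rewrite act_iscale !tin_iscale iscaleK tinNr; lra.
by apply: adj_unique => u v; rewrite -act_single -tin_singler sym tin_singler act_single rinC.
Qed.

Lemma rin_le_tin (T : 'B(H)) x i j : rin (T (x j)) (x i) <= rnorm T * tin x x.
Proof.
have le k : rnorm (x k) ^+ 2 <= tin x x.
  by rewrite -rin_norm /tin (bigD1 k)//= lerDl sumr_ge0// => l _; exact: rin_ge0.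
rewrite (le_trans (rin_CauchySchwarz _ _))//.
rewrite (le_trans (_ : _ <= rnorm T * rnorm (x j) * rnorm (x i)))//.
  by rewrite ler_wpM2r ?rnorm_ge0 ?rnorm_bop.
rewrite -mulrA ler_wpM2l ?rnorm_ge0//.
by have := le i; have := le j; have := sqr_ge0 (rnorm (x i) - rnorm (x j)); nra.
Qed.

End OperatorMatrix.

Section StarRepCompletelyPositive.
Variables (R : realType) (H K : hilbertType R) (A : set 'B(H)).
Variable f : 'B(H) -> 'B(K).
Hypothesis hA : unital_Cstar_algebra A.
Hypothesis hf : star_rep A f.

Lemma calg_sum (I : Type) (r : seq I) (P : pred I) (F : I -> 'B(H)) :
  (forall i, A (F i)) -> A (\sum_(i <- r | P i) F i).
Proof.
move=> AF; elim/big_rec: _ => [|i x _ Ax]; first exact: (calg0 hA).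
exact: (calgD hA).
Qed.

Lemma linear_on_sum (g : 'B(H) -> 'B(K)) (I : Type) (r : seq I) (F : I -> 'B(H)) :
  linear_on A g -> (forall i, A (F i)) ->
  g (\sum_(i <- r) F i) = \sum_(i <- r) g (F i).
Proof.
move=> gl AF; elim: r => [|i r IHr]; first by rewrite !big_nil (linear_on0 hA gl).
by rewrite !big_cons (linear_onD gl) ?IHr//; exact: calg_sum.
Qed.

Lemma star_rep_mxX n (X : 'M['B(H)]_n) k : (forall i j, A (X i j)) ->
  (forall i j, A ((X ^+ k) i j)) /\ map_mx f (X ^+ k) = map_mx f X ^+ k.
Proof.
have [[fl fM _] f1] := hf; move=> AX; elim: k => [|k [AXk IHk]].
  split=> [i j|]; first by rewrite mxE; case: eqP => _; [exact: (calg1 hA)|exact: (calg0 hA)].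
  apply/matrixP => i j; rewrite !mxE; case: eqP => _; first exact: f1.
  exact: (linear_on0 hA fl).
split=> [i j|]; first by rewrite exprS mxE; apply: calg_sum => l; exact: (calgM hA).
rewrite !exprS -IHk; apply/matrixP => i j; rewrite !mxE (linear_on_sum _ fl)//.
  by apply: eq_bigr => l _; rewrite fM// !mxE.
by move=> l; exact: (calgM hA).
Qed.

(* For [0 <= T <= c] the powers of [X = 1 - T / c] have entries of norm at most
   [1], and so do the powers of the symmetric matrix [f X], as [f] is
   contractive; hence [f X <= 1]. *)
Lemma star_rep_completely_positive : completely_positive A f.
Proof.
have [[fl fM fadj] f1] := hf; move=> n T AT /positive_mxP[Tsym Tpos].
(* An upper bound for [T] as a form, made positive by the summand [1] so that it can be inverted. *)
pose c := 1 + \sum_i \sum_j rnorm (T i j).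
have c0 : 0 < c.
  by rewrite ltr_pwDl// sumr_ge0// => i _; apply: sumr_ge0 => j _; exact: rnorm_ge0.
have Tc x : tin (act T x) x <= c * tin x x.
  rewrite mulrDl mul1r ler_wpDl ?tin_ge0// mulr_suml.
  apply: ler_sum => i _; rewrite rin_suml mulr_suml.
  by apply: ler_sum => j _; exact: rin_le_tin.
pose X := \matrix_(i, j) ((1 : 'M['B(H)]_n) i j - c^-1%:C *: T i j).
have AX i j : A (X i j).
  rewrite mxE; apply: (calgB hA); last exact: (calgZ hA).
  by rewrite mxE; case: eqP => _; [exact: (calg1 hA)|exact: (calg0 hA)].
have Xsym i j : adj (X i j) = X j i.
  rewrite !mxE adjB adjZr Tsym eq_sym; case: eqP => _; rewrite ?adj1//.
  by congr (_ - _); apply: adj_unique => u v /=; rewrite rin0l rin0r.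
have actX' (L : hilbertType R) (S : 'M['B(L)]_n) x :
    act (\matrix_(i, j) ((1 : 'M['B(L)]_n) i j - c^-1%:C *: S i j)) x =
    x - (fun i => c^-1%:C *: act S x i).
  apply/funext => i; rewrite /act; under eq_bigr do rewrite mxE /= scaleN1r.
  rewrite sumrB -scaler_sumr; congr (_ - _).
  by have := congr1 (@^~ i) (act1 x).
have tinZ (L : hilbertType R) (u v : 'I_n -> L) :
    tin (fun i => c^-1%:C *: u i) v = c^-1 * tin u v.
  by rewrite /tin mulr_sumr; apply: eq_bigr => i _; rewrite rinZl.
have Xcontr x : tin (act X x) (act X x) <= tin x x.
  apply: (form_sqr_contraction (@tinDl _ H n) (@tinNl _ H n) (@tinC _ H n)) => [u v|u v|u].
  - exact: act_sym.
  - exact: actB.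
  rewrite actX' tinDl tinNl tinZ; apply/andP; split.
    by rewrite subr_ge0 mulrC ler_pdivrMr// mulrC.
  by rewrite gerDl oppr_le0 mulr_ge0// invr_ge0 ltW.
have Xk k x : tin (act (X ^+ k) x) (act (X ^+ k) x) <= tin x x.
  rewrite actX; elim: k => [|k IHk]//=; exact: le_trans (Xcontr _) IHk.
have Xk1 k i j : rnorm ((X ^+ k) i j) <= 1.
  apply: rnorm_bop_le => // u; rewrite mul1r.
  rewrite -(ler_pXn2r (n:=2)) ?nnegrE ?rnorm_ge0// -!rin_norm.
  have := Xk k (single j u); rewrite tin_singler {3}/single eqxx; apply: le_trans.
  rewrite -act_single /tin [leRHS](bigD1 i)//= lerDl.
  by apply: sumr_ge0 => l _; exact: rin_ge0.
have fXsym i j : adj ((map_mx f X) i j) = (map_mx f X) j i.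
  by rewrite [in LHS]mxE [RHS]mxE -fadj// Xsym.
apply/positive_mxP; split=> [i j|y]; first by rewrite !mxE -fadj// Tsym.
have fXE : map_mx f X =
    \matrix_(i, j) ((1 : 'M['B(K)]_n) i j - c^-1%:C *: (map_mx f T) i j).
  apply/matrixP => i j; rewrite !mxE (linear_onB hA fl)//; last exact: (calgZ hA).
    rewrite (linear_onZ hA _ fl)//; congr (_ - _); case: eqP => _; first exact: f1.
    exact: (linear_on0 hA fl).
  by case: eqP => _; [exact: (calg1 hA)|exact: (calg0 hA)].
have := @form_power_bounded _ _ _ (@tinDl _ K n) (@tinNl _ K n) (@tinC _ K n)
  (@tin_ge0 _ K n) (act (map_mx f X)) (fun u v => act_sym u v fXsym) y
  (\sum_(i < n) (\sum_j rnorm (y j)) ^+ 2).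
(* This bound does not depend on [k]: the entries of [f (X ^+ k)] are contractions, so each
   component of the iterate has norm at most the sum of the [rnorm (y j)]. *)
have bnd k : tin (iter k (act (map_mx f X)) y) (iter k (act (map_mx f X)) y) <=
    \sum_(i < n) (\sum_j rnorm (y j)) ^+ 2.
  have [AXk fXk] := star_rep_mxX k AX; rewrite -actX -fXk.
  apply: ler_sum => i _; rewrite rin_norm ler_pXn2r ?nnegrE ?rnorm_ge0//; last first.
    by apply: sumr_ge0 => j _; exact: rnorm_ge0.
  have sum_le : forall (r : seq 'I_n) (F : 'I_n -> K),
      rnorm (\sum_(j <- r) F j) <= \sum_(j <- r) rnorm (F j).
    move=> r F; elim: r => [|j r IHr]; first by rewrite !big_nil rnorm0.
    by rewrite !big_cons (le_trans (rnormD _ _))// lerD.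
  rewrite (le_trans (sum_le _ _))//; apply: ler_sum => j _.
  rewrite (le_trans (rnorm_bop _ _))// mxE ler_piMl ?rnorm_ge0//.
  exact: le_trans (star_rep_contractive hA hf (AXk i j)) (Xk1 k i j).
(* Since [f X = 1 - f T / c], the inequality [f X <= 1] says that [f T] is positive. *)
move=> /(_ bnd); rewrite {1}fXE actX' tinDl tinNl tinZ gerDl oppr_le0.
by rewrite pmulr_rge0 ?invr_gt0.
Qed.

End StarRepCompletelyPositive.

(** * Schwarz inequality and multiplicative domain *)

Section Ucp.
Variables (R : realType) (H K : hilbertType R) (A : set 'B(H)).
Variable f : 'B(H) -> 'B(K).
Hypothesis hA : unital_Cstar_algebra A.
Hypothesis hf : ucp A f.

(** The form at [x] is the squared norm of the sum of the [a j (x j)]. *)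
Lemma gram_positive n (a : 'I_n -> 'B(H)) :
  positive_mx (\matrix_(i, j) (adj (a i) * a j)).
Proof.
apply/positive_mxP; split=> [i j|x]; first by rewrite !mxE adjM adjK.
rewrite (_ : tin _ _ = rin (\sum_j a j (x j)) (\sum_i a i (x i))) ?rin_ge0//.
rewrite rin_sumr; apply: eq_bigr => i _; rewrite -rin_adjl linear_sum/=.
by congr rin; apply: eq_bigr => j _; rewrite mxE.
Qed.

Lemma ucp_gram n (a : 'I_n -> 'B(H)) : (forall i, A (a i)) ->
  (forall i j, adj (f (adj (a i) * a j)) = f (adj (a j) * a i)) /\
  forall z : 'I_n -> K, 0 <= \sum_i \sum_j rin (f (adj (a i) * a j) (z j)) (z i).
Proof.
have [_ _ fcp] := hf; move=> Aa.
have /positive_mxP[fsym fpos] : positive_mx (map_mx f (\matrix_(i, j) (adj (a i) * a j))).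
  apply: fcp (gram_positive a) => i j; rewrite mxE.
  by apply: (calgM hA) => //; exact: (calg_adj hA).
split=> [i j|z]; first by have := fsym i j; rewrite !mxE.
have := fpos z; rewrite /tin; congr (_ <= _); apply: eq_bigr => i _.
by rewrite rin_suml; apply: eq_bigr => j _; rewrite !mxE.
Qed.

(** Read off from the symmetry of the image of the Gram matrix of [1] and [x], at an off-diagonal
    entry. *)
Lemma ucp_adj x : A x -> f (adj x) = adj (f x).
Proof.
move=> Ax; have Aa (i : 'I_2) : A ([:: 1; x]`_i).
  by case: i => -[|[|//]] i /=; [exact: (calg1 hA)|].
have [/(_ ord0 (lift ord0 ord0))/= + _] := ucp_gram Aa.
by rewrite adj1 mul1r mulr1.
Qed.

(** Test the image of the Gram matrix of [1, x, y] on the vector [(- (f x u + f y v), u, v)], whose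
    first entry completes the square. *)
Lemma ucp_schwarz2 x y u v : A x -> A y ->
  rnorm (f x u + f y v) ^+ 2 <=
  rin (f (adj x * x) u) u + rin (f (adj x * y) v) u +
  rin (f (adj y * x) u) v + rin (f (adj y * y) v) v.
Proof.
have [fl f1 _] := hf.
move=> Ax Ay; have Aa (i : 'I_3) : A ([:: 1; x; y]`_i).
  by case: i => -[|[|[|//]]] i /=; [exact: (calg1 hA)| |].
have [_ /(_ (fun i => [:: - (f x u + f y v); u; v]`_i))] := ucp_gram Aa.
rewrite !big_ord_recl !big_ord0 /= adj1 !mul1r !mulr1 f1 !ucp_adj// -rin_norm.
rewrite !rin_adjl (rinC (- _) (f x u)) (rinC (- _) (f y v)).
rewrite !(rinDl, rinDr, rinNl, rinNr) (rinC (f y v) (f x u)); lra.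
Qed.

Lemma ucp_schwarz x u : A x -> rnorm (f x u) ^+ 2 <= rin (f (adj x * x) u) u.
Proof.
move=> Ax; have := @ucp_schwarz2 x x u 0 Ax Ax.
by rewrite !linear0 !(rin0l, rin0r) !addr0.
Qed.

Lemma ucp_positive S u : A S -> adj S = S -> (forall w, 0 <= rin (S w) w) ->
  0 <= rin (f S u) u.
Proof.
have [_ _ fcp] := hf; move=> AS Ssa Spos.
have /positive_mxP[_ /(_ (fun=> u))] : positive_mx (map_mx f (const_mx S : 'M_1)).
  apply: fcp => [i j|]; first by rewrite mxE.
  apply/positive_mxP; split=> [i j|w]; first by rewrite !mxE.
  by rewrite /tin big_ord1 /act big_ord1 mxE.
by rewrite /tin big_ord1 /act big_ord1 !mxE.
Qed.

(** Combine the Schwarz inequality with positivity of [f] at [|x|^2 - x^* x]. *)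
Lemma ucp_contractive x : A x -> rnorm (f x) <= rnorm x.
Proof.
have [fl f1 _] := hf; move=> Ax.
apply: rnorm_bop_le => [|u]; first exact: rnorm_ge0.
rewrite -(ler_pXn2r (n:=2)) ?nnegrE ?mulr_ge0 ?rnorm_ge0//.
rewrite (le_trans (ucp_schwarz u Ax))// exprMn.
have Axx : A (adj x * x) by apply: (calgM hA) => //; exact: (calg_adj hA).
have A1 := calg1 hA.
have := @ucp_positive ((rnorm x ^+ 2)%:C *: (1 : 'B(H)) - adj x * x) u.
rewrite (linear_onB hA fl)//; last exact: (calgZ hA).
rewrite (linear_onZ hA _ fl)// f1 /= scaleN1r rinDl rinNl rinZl subr_ge0 rin_norm; apply.
- by apply: (calgB hA) => //; exact: (calgZ hA).
- by rewrite adjB adjZr adj1 adjM adjK.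
- move=> w; rewrite /= scaleN1r rinDl rinNl rinZl subr_ge0 rin_adjl !rin_norm.
  by rewrite -exprMn ler_pXn2r ?nnegrE ?mulr_ge0 ?rnorm_ge0 ?rnorm_bop.
Qed.

Lemma le_mul_bounded_eq0 (d C : R) : (forall t, t * d <= C) -> d = 0.
Proof.
move=> tdC; apply/eqP/negPn/negP => d0.
by have := tdC ((C + 1) / d); rewrite divfK//; lra.
Qed.

(* Scaling [u] in [ucp_schwarz2] kills the cross term. *)
Lemma ucp_multiplicative_domain x y : A x -> A y ->
  f (adj x * x) = adj (f x) * f x -> f (y * x) = f y * f x.
Proof.
move=> Ax Ay fxx; have Ay' := calg_adj hA Ay.
apply: bop_rin_inj => u v; apply/esym/subr0_eq.
(* The equality for [x] cancels the terms quadratic in [t]; what bounds the linear one is the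
   Schwarz defect of [adj y] at [v], independent of [t]. *)
apply: (@le_mul_bounded_eq0 _ (rin (f (y * adj y) v) v - rin (f (adj y) v) (f (adj y) v))) => t.
have := @ucp_schwarz2 x (adj y) ((t / 2)%:C *: u) v Ax Ay'.
rewrite fxx adjK -adjM (ucp_adj (calgM hA Ay Ax)) -rin_norm.
rewrite [f x _]linearZ [f (y * x) _]linearZ [(adj (f x) * f x) _]linearZ/=.
rewrite !(rinDl, rinDr, rinZl, rinZr) (ucp_adj Ay) !rin_adjl.
rewrite (rinC v (f (y * x) u)) (rinC _ (adj (f y) v)) rin_adjl (rinC v); lra.
Qed.

End Ucp.

(** * Extending identities from generators to the generated C*-algebra *)

Section UniqueExtension.
Variables (R : realType) (H K : hilbertType R).

Lemma bop_form_inj (S T : 'B(H)) : adj S = S -> adj T = T ->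
  (forall u, rin (S u) u = rin (T u) u) -> S = T.
Proof.
move=> Ssa Tsa ST; apply: bop_rin_inj => u v; have := ST (u + v).
rewrite !linearD !(rinDl, rinDr) !ST.
have sym (U : 'B(H)) : adj U = U -> rin (U v) u = rin (U u) v.
  by move=> Usa; rewrite rin_adj Usa rinC.
rewrite !sym//; lra.
Qed.

(** The elements on which [f] and [g] agree form a C*-algebra, closed because both maps are
    contractive. *)
Lemma star_rep_eq (M : set 'B(H)) (f g : 'B(H) -> 'B(K)) :
  star_rep (Cstar M) f -> star_rep (Cstar M) g -> (forall t, M t -> f t = g t) ->
  forall t, Cstar M t -> f t = g t.
Proof.
have hC := Cstar_algebra M; move=> hf hg fg.
have [[fl fM fadj] f1] := hf; have [[gl gM gadj] g1] := hg.
suff : Cstar M `<=` [set t | Cstar M t /\ f t = g t] by move=> sub t /sub[].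
apply: Cstar_min; last by move=> t Mt; split; [exact: sub_Cstar|exact: fg].
split; first split; first split.
- by split; [exact: (calg0 hC)|rewrite (linear_on0 hC fl) (linear_on0 hC gl)].
- move=> a S T [MS fgS] [MT fgT]; split; first exact: (calg_lin hC).
  by rewrite fl// gl// fgS fgT.
- by split; [exact: (calg1 hC)|rewrite f1 g1].
- move=> S T [MS fgS] [MT fgT]; split; first exact: (calgM hC).
  by rewrite fM// gM// fgS fgT.
- by move=> T [MT fgT]; split; [exact: (calg_adj hC)|rewrite fadj// gadj// fgT].
move=> T /closure_rnormP cT.
have MT : Cstar M T by apply: (calg_closure hC) => e /cT[S []]; exists S.
split=> //; apply/subr0_eq/(@rnorm_small _ _ _ 2) => e /cT[S [MS fgS] ST].
rewrite (_ : f T - g T = f (T - S) - g (T - S)); last first.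
  by rewrite (linear_onB hC fl)// (linear_onB hC gl)// fgS opprB addrA subrK.
have MTS := calgB hC MT MS; rewrite (le_trans (rnormD _ _))// rnormN.
have := star_rep_contractive hC hf MTS; have := star_rep_contractive hC hg MTS; lra.
Qed.

(** The preimage of [B] in [Cstar M] is itself a C*-algebra, again closed by contractivity. *)
Lemma star_rep_image_sub (M : set 'B(H)) (B : set 'B(K)) (f : 'B(H) -> 'B(K)) :
  unital_Cstar_algebra B -> star_rep (Cstar M) f -> (forall t, M t -> B (f t)) ->
  forall t, Cstar M t -> B (f t).
Proof.
have hC := Cstar_algebra M; move=> hB hf fB; have [[fl fM fadj] f1] := hf.
suff : Cstar M `<=` [set t | Cstar M t /\ B (f t)] by move=> sub t /sub[].
apply: Cstar_min; last by move=> t Mt; split; [exact: sub_Cstar|exact: fB].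
split; first split; first split.
- by split; [exact: (calg0 hC)|rewrite (linear_on0 hC fl); exact: (calg0 hB)].
- move=> a S T [MS BS] [MT BT]; split; first exact: (calg_lin hC).
  by rewrite fl//; exact: (calg_lin hB).
- by split; [exact: (calg1 hC)|rewrite f1; exact: (calg1 hB)].
- move=> S T [MS BS] [MT BT]; split; first exact: (calgM hC).
  by rewrite fM//; exact: (calgM hB).
- move=> T [MT BT]; split; first exact: (calg_adj hC).
  by rewrite fadj//; exact: (calg_adj hB).
move=> T /closure_rnormP cT.
have MT : Cstar M T by apply: (calg_closure hC) => e /cT[S []]; exists S.
split=> //; apply: (calg_closure hB) => e /cT[S [MS BS] ST]; exists (f S) => //.
rewrite -(linear_onB hC fl)//; apply: le_trans ST.
exact: (star_rep_contractive hC hf (calgB hC MT MS)).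
Qed.

(* The last hypothesis puts [G] into the multiplicative domain of [g]. *)
Lemma ucp_eq_star_rep (G : set 'B(H)) (f g : 'B(H) -> 'B(K)) :
  star_rep (Cstar G) f -> ucp (Cstar G) g -> (forall t, G t -> g t = f t) ->
  (forall t, G t -> g (adj t * t) = adj (g t) * g t /\
                    g (t * adj t) = g t * adj (g t)) ->
  forall t, Cstar G t -> g t = f t.
Proof.
have hC := Cstar_algebra G; move=> hf hg gf gG; have [gl g1 _] := hg.
(* Requiring multiplicativity on both sides against every [y] makes this set stable under products
   and adjoints, so it only has to contain [G]. *)
suff gM : Cstar G `<=` [set x | Cstar G x /\ forall y, Cstar G y ->
    g (y * x) = g y * g x /\ g (x * y) = g x * g y].
  apply: (@star_rep_eq G g f) => //; split=> //; split=> //.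
    by move=> S T /gM[GS gS] /gS[].
  by move=> T; exact: (ucp_adj hC hg).
apply: Cstar_min; last first.
  move=> x Gx; have Cx := sub_Cstar Gx; split=> // y Cy; have [gxx gxx'] := gG x Gx.
  split; first exact: (ucp_multiplicative_domain hC hg).
  have Cx' := calg_adj hC Cx; have Cy' := calg_adj hC Cy.
  (* Multiplication on the other side is reduced to the first case by adjoints; there the condition
     on [x * adj x] enters. *)
  rewrite -[x * y]adjK (ucp_adj hC hg); last by apply: (calg_adj hC); exact: (calgM hC).
  rewrite adjM (ucp_multiplicative_domain hC hg)//.
    by rewrite adjM -!(ucp_adj hC hg)// !adjK.
  by rewrite !(ucp_adj hC hg)// !adjK.
split; first split; first split.
- split=> [|y Cy]; first exact: (calg0 hC).
  by rewrite !(mul0r, mulr0) (linear_on0 hC gl) !(mul0r, mulr0).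
- move=> a S T [CS gS] [CT gT]; split=> [|y Cy]; first exact: (calg_lin hC).
  have [[gS1 gS2] [gT1 gT2]] := (gS y Cy, gT y Cy).
  have scalerAr' (L : hilbertType R) (U V W : 'B(L)) : U * (a *: V + W) = a *: (U * V) + U * W.
    by apply: bopP => u /=; rewrite linearP.
  have scalerAl' (L : hilbertType R) (U V W : 'B(L)) : (a *: V + W) * U = a *: (V * U) + W * U.
    exact: bopP.
  rewrite scalerAr' scalerAl' !gl ?scalerAr' ?scalerAl' ?gS1 ?gS2 ?gT1 ?gT2//;
    exact: (calgM hC).
- split=> [|y Cy]; first exact: (calg1 hC).
  by rewrite g1 !mul1r !mulr1.
- move=> S T [CS gS] [CT gT]; split=> [|y Cy]; first exact: (calgM hC).
  have [gyS _] := gS y Cy; have [_ gTy] := gT y Cy; have [_ gST] := gS T CT.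
  have [gyST _] := gT (y * S) (calgM hC Cy CS).
  have [_ gSTy] := gS (T * y) (calgM hC CT Cy).
  by split; [rewrite mulrA gyST gyS gST mulrA|rewrite -mulrA gSTy gTy gST mulrA].
- move=> T [CT gT]; split=> [|y Cy]; first exact: (calg_adj hC).
  have [Cy' CT'] := (calg_adj hC Cy, calg_adj hC CT); have [gyT gTy] := gT _ Cy'.
  have CyT := calgM hC Cy' CT; have CTy := calgM hC CT Cy'.
  have [gadjy gadjT] := (ucp_adj hC hg Cy, ucp_adj hC hg CT); split.
    by rewrite -{1}[y]adjK -adjM (ucp_adj hC hg CTy) gTy adjM gadjy adjK gadjT.
  by rewrite -{1}[y]adjK -adjM (ucp_adj hC hg CyT) gyT adjM gadjy adjK gadjT.
move=> T /closure_rnormP cT.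
have CT : Cstar G T by apply: (calg_closure hC) => e /cT[S []]; exists S.
(* With [S] near [T], the defect of [T] is that of [T - S], a difference of two terms each of norm
   at most [rnorm y * e]. *)
split=> // y Cy; split; apply/subr0_eq/(@rnorm_small _ _ _ (2 * rnorm y)) => e /cT[S [CS gS] ST].
  have [gyS _] := gS y Cy; have CTS := calgB hC CT CS.
  rewrite (_ : _ - _ = g (y * (T - S)) - g y * g (T - S)); last first.
    rewrite mulrBr !(linear_onB hC gl)//; [|exact: (calgM hC)..].
    by rewrite mulrBr gyS opprB addrA subrK.
  rewrite (le_trans (rnormD _ _))// rnormN.
  have := ucp_contractive hC hg (calgM hC Cy CTS); have := rnormM y (T - S).
  have := rnormM (g y) (g (T - S)); have := ucp_contractive hC hg Cy.
  have := ucp_contractive hC hg CTS; have := rnorm_ge0 y; have := rnorm_ge0 (g y).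
  have := rnorm_ge0 (g (T - S)); nra.
have [_ gSy] := gS y Cy; have CTS := calgB hC CT CS.
rewrite (_ : _ - _ = g ((T - S) * y) - g (T - S) * g y); last first.
  rewrite mulrBl !(linear_onB hC gl)//; [|exact: (calgM hC)..].
  by rewrite mulrBl gSy opprB addrA subrK.
rewrite (le_trans (rnormD _ _))// rnormN.
have := ucp_contractive hC hg (calgM hC CTS Cy); have := rnormM (T - S) y.
have := rnormM (g (T - S)) (g y); have := ucp_contractive hC hg Cy.
have := ucp_contractive hC hg CTS; have := rnorm_ge0 y; have := rnorm_ge0 (g y).
have := rnorm_ge0 (g (T - S)); nra.
Qed.

End UniqueExtension.

(** * The unique extension property and minimality of [Gamma] *)

Theorem theorem4p4 (R : realType) (H Hpi : hilbertType R) (M : set 'B(H))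
    (pi psi : 'B(H) -> 'B(Hpi)) (Gamma : 'B(Hpi) -> 'B(Hpi)) :
  unital_operator_space M ->
  star_rep (Cstar M) pi ->
  approx_unique_extension M pi ->
  ucp (Cstar M) psi ->
  (forall t, M t -> psi t = pi t) ->
  is_Gamma (Cstar M) pi psi Gamma ->
  (forall (Hsigma : hilbertType R) (sigma : 'B(Hpi) -> 'B(Hsigma)),
     star_rep (Cstar (psi @` Cstar M)) sigma ->
     (forall t, ker_on (Cstar (psi @` Cstar M)) Gamma t -> sigma t = 0) ->
     unique_extension (psi @` Cstar M) sigma) /\
  minimal_projection (pi @` Cstar M)
    (Cstar (psi @` Cstar M)) [set: 'B(Hpi)] Gamma.
Proof.
move=> _ hpi _ hpsi psipi [hGamma Gpi Gpsi].
have [[pil piM piadj] pi1] := hpi; have [psil psi1 _] := hpsi.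
have [Gl GM Gadj] := hGamma.
set A := Cstar M; set B := Cstar (psi @` A).
have hA : unital_Cstar_algebra A := Cstar_algebra M.
have hB : unital_Cstar_algebra B := Cstar_algebra _.
have Bpsi t : A t -> B (psi t) by move=> At; apply: (@sub_Cstar _ _ (psi @` A)); exists t.
have Bpi : forall t, A t -> B (pi t).
  apply: star_rep_image_sub => // t Mt.
  by rewrite -psipi//; apply: Bpsi; exact: sub_Cstar.
have hG : star_rep B Gamma by split=> //; rewrite -[in LHS]psi1 Gpsi ?pi1//; exact: (calg1 hA).
(* [Gamma \o pi] and [pi] are *-representations of [A] that agree on [M], where [pi = psi]. *)
have Gammapi : forall t, A t -> Gamma (pi t) = pi t.
  apply: (@star_rep_eq _ _ _ M (Gamma \o pi)) => //; last first.
    by move=> t Mt /=; rewrite -{1}psipi// Gpsi//; exact: sub_Cstar.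
  split; last by rewrite /= pi1 hG.2.
  split=> [a S T AS AT|S T AS AT|T AT] /=.
  - by rewrite pil// Gl//; exact: Bpi.
  - by rewrite piM// GM//; exact: Bpi.
  - by rewrite piadj// Gadj//; exact: Bpi.
split=> [L sigma hsigma sigma0 g hg gsigma|].
  (* The difference [psi t - pi t] lies in the kernel of [Gamma], as both terms are sent to
     [pi t]. *)
  have sigmapsi t : A t -> sigma (psi t) = sigma (pi t).
    move=> At; have [sl _ _] := hsigma.1.
    have [Bps Bp] := (Bpsi t At, Bpi t At); apply/subr0_eq.
    rewrite -(linear_onB hB sl)//; apply: sigma0; split; first exact: (calgB hB).
    by rewrite (linear_onB hB Gl)// Gpsi// Gammapi// subrr.
  have gpsi t : A t -> g (psi t) = sigma (pi t).
    by move=> At; rewrite gsigma ?sigmapsi//; exists t.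
  have [gl _ _] := hg; have [_ sM sadj] := hsigma.1.
  have mult t : A t -> g (adj (psi t) * psi t) = adj (g (psi t)) * g (psi t).
    move=> At; have At' := calg_adj hA At; have Att := calgM hA At' At.
    have Bt := Bpsi t At; have Bt' := calg_adj hB Bt; have Btt := calgM hB Bt' Bt.
    have psisq : psi (adj t * t) = adj (psi (adj t * t)).
      by rewrite -(ucp_adj hA hpsi)// adjM adjK.
    (* Both sides are self-adjoint, so it suffices to compare quadratic forms, which the two Schwarz
       inequalities bound from both sides. *)
    apply: bop_form_inj => [||u].
    - by rewrite -(ucp_adj hB hg)// adjM adjK.
    - by rewrite adjM adjK.
    apply/le_anti; rewrite [X in _ && X]/= rin_adjl rin_norm (ucp_schwarz hB hg)// andbT.
    (* Here [g \o psi] equals [sigma \o pi] on [A], which is a *-homomorphism. *)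
    have -> : rnorm (g (psi t) u) ^+ 2 = rin (g (psi (adj t * t)) u) u.
      have Bt1 := Bpi _ At; have Bt2 := calg_adj hB Bt1.
      by rewrite !gpsi// piM// piadj// sM// sadj// /= rin_adjl rin_norm.
    rewrite -subr_ge0 -rinNl -rinDl.
    have := @ucp_positive _ _ _ _ _ hg (psi (adj t * t) - adj (psi t) * psi t) u.
    rewrite (linear_onB hB gl) ?Bpsi//= ?scaleN1r; last exact: Bpsi.
    apply; first by apply: (calgB hB) => //; exact: Bpsi.
      by rewrite adjB -psisq adjM adjK.
    move=> w; rewrite /= scaleN1r rinDl rinNl rin_adjl rin_norm subr_ge0.
    exact: (ucp_schwarz hA hpsi).
  apply: ucp_eq_star_rep => // _ [t At <-]; split; first exact: mult.
  (* The second multiplicative-domain identity is the first one at [adj t]. *)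
  have At' := calg_adj hA At; have := mult _ At'.
  by rewrite !(ucp_adj hA hpsi)// adjK (ucp_adj hB hg) ?adjK//; exact: Bpsi.
have GB t : B t -> exists2 s, A s & Gamma t = pi s.
  by move=> Bt; have [|s As <-] := Gpi (Gamma t); [exists t|exists s].
split.
- split.
  + split=> //; split=> //; first exact: hG.2.
    exact: star_rep_completely_positive.
  + by move=> _ [t Bt <-]; have [s As ->] := GB t Bt; exact: Bpi.
  + by move=> t Bt; have [s As ->] := GB t Bt; rewrite Gammapi.
- by move=> _ [t At <-]; exact: Gammapi.
- move=> g _ gpi gG t Bt; have [<- _] := gG t Bt.
  by have [s As ->] := GB t Bt; apply: gpi; exists s.
Qed.
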